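(* Let $P_{Y|X}$ be a channel from an input set $\mathcal X$ to an output space $\mathcal Y$. Suppose there is a simulator consisting of common randomness $Z$ (independent of the input), a transcript $T=T(X,Z)$ taking values in a finite set $\mathcal T$ with $|\mathcal T|\le 2^Q$, and an output $\widehat Y=\widehat Y(T,Z)$, such that for every input $x\in\mathcal X$, \[ d_{\mathrm{TV}}\bigl(P_{\widehat Y|X=x},P_{Y|X=x}\bigr)\le\delta_{\mathrm{TV}}. \] Let $\epsilon(k')$ be an achievable average error probability for transmitting a $k'$-bit message over $P_{Y|X}$. Then for every $k'$ with $\delta_{\mathrm{TV}}+\epsilon(k')<1$, \[ Q\ge k'-\log_2\frac{1}{1-\delta_{\mathrm{TV}}-\epsilon(k')}. \]
   Context: $d_{\mathrm{TV}}$ is total variation distance. $P_{\widehat Y|X=x}$ is the law of $\widehat Y$ when the input is $x$, over the randomness of $Z$. ''$\epsilon(k')$ is an achievable average error probability for transmitting a $k'$-bit message'' means: there exist an encoder $m\mapsto x(m)\in\mathcal X$ on $\{1,\dots,2^{k'}\}$ and a decoder $\varphi:\mathcal Y\to\{1,\dots,2^{k'}\}$ such that, for $M$ uniform on $\{1,\dots,2^{k'}\}$ and $Y\sim P_{Y|X=x(M)}$, $\mathbb P(\varphi(Y)\ne M)\le\epsilon(k')$. *)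

(* Defs.v *)
From HB Require Import structures.
From mathcomp Require Import all_boot all_order all_algebra.
From mathcomp Require Import all_classical all_reals all_analysis.

Set Implicit Arguments.
Unset Strict Implicit.
Unset Printing Implicit Defensive.

Import Order.TTheory GRing.Theory Num.Theory.

Local Open Scope classical_set_scope.
Local Open Scope ring_scope.

Definition log2 (R : realType) (x : R) : R := ln x / ln 2.

(* Normalized so that 0 <= dTV <= 1 on probability measures, i.e. half of the
   total variation norm of [mu - nu]. *)
Definition dTV d (T : measurableType d) (R : realType)
    (mu nu : set T -> \bar R) : \bar R :=
  ereal_sup [set `|mu A - nu A|%E | A in [set A : set T | measurable A]].

(* P(phi(Y) <> M) for M uniform on the n messages and, given M = m, Y
   distributed as [W (enc m)]. *)
Definition average_error (X : Type) d (Y : measurableType d) (R : realType)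
    (W : X -> probability Y R) (n : nat) (enc : 'I_n -> X) (phi : Y -> 'I_n) :
    \bar R :=
  (\sum_(m < n) (n%:R^-1)%:E * W (enc m) [set y | phi y != m])%E.

(* Messages are indexed from 0. The condition on the fibres of [phi] is
   measurability of the decoder for the discrete sigma-algebra on messages. *)
Definition achievable (X : Type) d (Y : measurableType d) (R : realType)
    (W : X -> probability Y R) (k : nat) (e : R) : Prop :=
  exists (enc : 'I_(2 ^ k) -> X) (phi : Y -> 'I_(2 ^ k)),
    (forall m, measurable (phi @^-1` [set m])) /\
    (average_error W enc phi <= e%:E)%E.

(* Yhat(T(x, Z), Z) as a function of the common randomness; the law of [Z] does
   not depend on [x]. *)
Definition simulated (X Z Tr Y : Type) (T : X -> Z -> Tr) (Yhat : Tr -> Z -> Y)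
    (x : X) : Z -> Y := fun z => Yhat (T x z) z.

(* Main.v *)
(* Feed the decoder of the code with the simulated output. For a fixed value z
   of the common randomness, the decoded message depends on the sent one only
   through the transcript, so at most |T| messages are decoded correctly;
   integrating over z, the success probabilities of the simulated code sum to at
   most |T| <= 2^Q. Each of them is within delta of the corresponding success
   probability over the true channel, and the latter sum to at least
   2^k (1 - eps k). Hence 2^k (1 - delta - eps k) <= 2^Q. *)

Require Import Defs.
From HB Require Import structures.
From mathcomp Require Import all_boot all_order all_algebra.
From mathcomp Require Import all_classical all_reals all_analysis.
From mathcomp Require Import measurable_realfun lra.

Set Implicit Arguments.
Unset Strict Implicit.
Unset Printing Implicit Defensive.

Import Order.TTheory GRing.Theory Num.Theory.

Local Open Scope classical_set_scope.
Local Open Scope ring_scope.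

(** Summing the indicators inside the integral counts the [i] with [t \in B i]; this count is at
    most [N] pointwise, and [P] has total mass 1. *)
Lemma sum_probability_le d (T : measurableType d) (R : realType)
    (P : probability T R) (I : finType) (B : I -> set T) (N : nat) :
    (forall i, measurable (B i)) ->
    (forall t, (#|[set i | t \in B i]%SET| <= N)%N) ->
  (\sum_i P (B i) <= N%:R%:E)%E.
Proof.
move=> mB cardB.
have -> : (\sum_i P (B i) = \int[P]_t (\sum_i (\1_(B i) t)%:E))%E.
  rewrite ge0_integral_sum //.
  - by apply: eq_bigr => i _; rewrite integral_indic// setIT.
  - by move=> i; apply/measurable_EFinP; exact: measurable_indic.
apply: (@le_trans _ _ (\int[P]_t (cst N%:R%:E t))%E); last first.
  by rewrite integral_cst// [X in (_ * X)%E]probability_setT mule1.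
apply: ge0_le_integral => //.
- by move=> t _; apply: sume_ge0.
- by apply: emeasurable_sum => i; apply/measurable_EFinP; exact: measurable_indic.
- move=> t _ /=; rewrite sumEFin lee_fin.
  rewrite (_ : \sum_i \1_(B i) t = #|[set i | t \in B i]%SET|%:R) ?ler_nat//.
  rewrite -sum1_card natr_sum [RHS]big_mkcond /=.
  by apply: eq_bigr => i _; rewrite indicE inE; case: (t \in B i).
Qed.

Lemma le_dTV d (T : measurableType d) (R : realType)
    (P : set T -> \bar R) (Q : set T -> \bar R) (A : set T) (delta : \bar R) :
  measurable A -> (dTV P Q <= delta)%E -> (`|P A - Q A| <= delta)%E.
Proof.
by move=> mA; apply: le_trans; apply: ereal_sup_ubound; exists A.
Qed.

(** Taking complements trades errors for success probabilities; [0 < n] makes the uniform weights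
    sum to 1. *)
Lemma average_errorE (X : Type) d (Y : measurableType d) (R : realType)
    (W : X -> probability Y R) (n : nat) (enc : 'I_n -> X) (phi : Y -> 'I_n) :
    (0 < n)%N -> (forall m, measurable (phi @^-1` [set m])) ->
  average_error W enc phi =
    (1 - n%:R^-1 * \sum_m fine (W (enc m) (phi @^-1` [set m])))%:E.
Proof.
move=> n0 mphi; rewrite /average_error.
under eq_bigr => m _.
  have -> : [set y | phi y != m] = ~` (phi @^-1` [set m]).
    by apply/seteqP; split => y /= /eqP.
  rewrite probability_setC// -[W _ _]fineK ?fin_num_measure// -EFinB -EFinM.
  over.
rewrite sumEFin -mulr_sumr sumrB sumr_const card_ord mulrBr mulVf//.
by rewrite pnatr_eq0 -lt0n.
Qed.

(** With [z] fixed, the transcript determines the simulated output and hence the decoded message. So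
    [m] to [T (enc m) z] is injective on the correctly decoded messages. *)
Lemma card_decoded_le (X Z Y : Type) (Tr : finType) (M : finType)
    (T : X -> Z -> Tr) (Yhat : Tr -> Z -> Y) (enc : M -> X) (phi : Y -> M)
    (z : Z) :
  (#|[set m | z \in (phi \o simulated T Yhat (enc m)) @^-1` [set m]]%SET|
     <= #|Tr|)%N.
Proof.
rewrite -(@card_in_imset _ _ (fun m => T (enc m) z)) ?max_card//.
move=> m m'; rewrite !inE /simulated /= => mz m'z Tmm'.
by rewrite -mz -m'z Tmm'.
Qed.

Theorem theorem4 (R : realType)
    (X : Type) (dY : measure_display) (Y : measurableType dY)
    (W : X -> probability Y R)
    (dZ : measure_display) (Z : measurableType dZ) (PZ : probability Z R)
    (Tr : finType) (T : X -> Z -> Tr) (Yhat : Tr -> Z -> Y)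
    (Q delta : R) (eps : nat -> R)
    (hYhat : forall x, measurable_fun [set: Z] (simulated T Yhat x))
    (hTr : #|Tr|%:R <= 2 `^ Q)
    (hsim : forall x,
       (dTV (pushforward PZ (simulated T Yhat x)) (W x) <= delta%:E)%E) :
  forall k : nat, achievable W k (eps k) -> delta + eps k < 1 ->
    Q >= k%:R - log2 (1 / (1 - delta - eps k)).
Proof.
move=> k [enc [phi [mphi err]]] de1.
set n := (2 ^ k)%N in enc phi mphi err.
have n0 : (0 < n)%N by rewrite expn_gt0.
have nR0 : 0 < n%:R :> R by rewrite ltr0n.
(* Success probabilities of message [m] under one and the same code: [p] over the true channel, [q]
   over the simulated one. *)
pose p m := fine (W (enc m) (phi @^-1` [set m])).
pose q m := fine (PZ ((phi \o simulated T Yhat (enc m)) @^-1` [set m])).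
have mB m : measurable ((phi \o simulated T Yhat (enc m)) @^-1` [set m]).
  by rewrite comp_preimage -[X in measurable X]setTI; apply: hYhat.
have pq m : p m <= q m + delta.
  (* The event tested in [dTV] is the decoding region of [m]. *)
  have := le_dTV (mphi m) (hsim (enc m)).
  rewrite /pushforward -comp_preimage -[PZ _]fineK ?fin_num_measure//.
  rewrite -[W _ _]fineK ?fin_num_measure// -EFinB lee_fin -/(p m) -/(q m).
  by rewrite ler_norml; lra.
have q_le : \sum_m q m <= #|Tr|%:R.
  rewrite -lee_fin -sumEFin.
  under eq_bigr do rewrite fineK ?fin_num_measure//.
  by apply: sum_probability_le => // z; exact: card_decoded_le.
have p_le : \sum_m p m <= #|Tr|%:R + n%:R * delta.
  apply: (le_trans (ler_sum _ (fun m _ => pq m))).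
  by rewrite big_split /= sumr_const card_ord mulr_natl lerD2r.
move: err; rewrite average_errorE// lee_fin -/p => err.
have {}err : n%:R * (1 - eps k) <= \sum_m p m.
  by rewrite mulrC -ler_pdivlMr// mulrC; move: err; lra.
(* Chains [err], [p_le] and [hTr], with [n * delta] moved to the left. *)
have main : n%:R * (1 - delta - eps k) <= 2 `^ Q by nra.
have c0 : 0 < 1 - delta - eps k by lra.
have ln2 : 0 < ln 2 :> R by rewrite ln_gt0// ltr1n.
(* After multiplication by [ln 2], the goal is the logarithm of [main]; [c0] makes the left side of
   [main] positive, so [ln] can be compared there. *)
rewrite /log2 div1r lnV ?posrE// mulNr opprK -(ler_pM2r ln2) mulrDl divfK ?gt_eqF//.
rewrite -!ln_powR powR_mulrn// -natrX -lnM ?posrE//.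
by rewrite ler_ln ?posrE ?mulr_gt0// powR_gt0.
Qed.
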